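(* (Propagating IKKT solution $\mathbb{R}^4\times T^2$.) A construction analogous to the one-cylinder construction of type $\mathbb{R}^3\times S^1$ described in the context, but using 2 fuzzy cylinders instead of one, gives a solution of the IKKT equations of motion of type $\mathbb{R}^2_\theta\times\mathbb{R}^2\times_\xi T^2$ (that is, with geometry $\mathbb{R}^4\times T^2$) in terms of 8 Hermitian matrices, with Minkowski signature in the non-compact space, i.e. the effective metric restricted to the non-compact space $\mathbb{R}^4$ has Minkowski signature.
   Context: Conventions: $\eta=\mathrm{diag}(-1,1,\dots,1)$ on indices $0,\dots,9$. The IKKT equations of motion for Hermitian matrices (operators on a separable Hilbert space) $X^0,\dots,X^9$ are $\Box X^a:=\sum_{b,c}\eta_{bc}[X^b,[X^c,X^a]]=0$ for all $a$; matrices that are not listed are zero. Fuzzy cylinder: a pair $(U,X)$ with $X=X^\dagger$ is a fuzzy cylinder with radius $R$ and NC modulus $\xi\in\mathbb{R}$ if $UU^\dagger=U^\dagger U=R^2$, $[U,X]=\xi U$, $[U^\dagger,X]=-\xi U^\dagger$. It is a quantization of $S^1\times\mathbb{R}$, denoted $S^1\times_\xi\mathbb{R}$, with $U\sim Re^{iy}$, $X\sim x$ and Poisson bracket $\{x,y\}=\xi$. The symbol $\mathbb{R}^2\times_\xi T^2$ refers to two such cylinders. $\mathbb{R}^2_\theta$ is the quantum plane generated by Hermitian $X^0,X^1$ with $[X^\mu,X^\nu]=i\theta^{\mu\nu}$, $\theta^{\mu\nu}$ a constant real antisymmetric non-degenerate matrix. Geometry: a matrix configuration is viewed as a quantized embedding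 $X^a\sim x^a:\mathcal{M}\hookrightarrow\mathbb{R}^{10}$ of a manifold with non-degenerate Poisson tensor $\theta^{AB}$ (semi-classical limit of commutators divided by $i$). With local coordinates $\zeta^A$ on $\mathcal{M}$, the induced metric is $g_{AB}=\partial_Ax^a\,\partial_Bx^b\,\eta_{ab}$, and the effective metric is $G^{AB}=\theta^{AA'}\theta^{BB'}g_{A'B'}$ (up to conformal factors). Its restriction to the non-compact space is the block of $G^{AB}$ with both indices in the non-compact coordinates. The one-cylinder construction: take a fuzzy cylinder $(U,X^2)$ with NC modulus $\xi$ and radius $R$, and a quantum plane $[X^\mu,X^\nu]=i\theta^{\mu\nu}$, $\mu,\nu=0,1$ (with $X^0$ time-like), which commutes with the cylinder. For real $k_0,k_1$ consider the matrices $X^0,X^1,X^2$ together with $X^4,X^5$ defined by $X^4+iX^5=U\,e^{ik_\mu X^\mu}$ (sum over $\mu=0,1$). With $k\cdot k:=\theta^{\mu\mu'}\theta^{\nu\nu'}\eta_{\mu'\nu'}k_\mu k_\nu$ (indices $0,1$), these satisfy $\Box X^a=0$ for $k\cdot k=-\xi^2$. They define a quantization of $\mathbb{R}^3\times S^1$, and the effective metric restricted to the non-compact $\mathbb{R}^3$ has Minkowski signature. *)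

(* Defs.v *)
From HB Require Import structures.
From mathcomp Require Import all_boot all_order all_algebra.
From mathcomp Require Import sesquilinear complex.
From mathcomp Require Import all_classical all_reals all_analysis.
Set Implicit Arguments.
Unset Strict Implicit.
Unset Printing Implicit Defensive.
Import Order.TTheory GRing.Theory Num.Theory numFieldNormedType.Exports.
Local Open Scope classical_set_scope.
Local Open Scope complex_scope.
Local Open Scope ring_scope.

(* The inner product is linear in the first argument. *)
Record hilbertSpace (R : realType) := HilbertSpace {
  hs_car :> completeNormedModType R[i];
  hs_dot : {dot hs_car for Num.conj};
  hs_norm : forall x : hs_car, hs_dot x x = `|x| ^+ 2;
  hs_separable : exists A : set hs_car, countable A /\ dense A
}.

(* The X^a of the models below are unbounded.  As usual, all operators are
   given on one dense subspace which they and their adjoints leave invariant,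
   so that products, commutators and equalities of operators make sense.
   [dd_incl] is the inclusion of that subspace. *)
Record denseDomain (R : realType) (H : hilbertSpace R) := DenseDomain {
  dd_car :> lmodType R[i];
  dd_incl : {linear dd_car -> H};
  dd_inj : injective dd_incl;
  dd_dense : dense (range dd_incl)
}.

Section Operators.
Variables (R : realType) (H : hilbertSpace R) (D : denseDomain H).

Definition dprod (phi psi : D) : R[i] :=
  hs_dot H (dd_incl D phi) (dd_incl D psi).

Record operator := Operator {
  oapp :> {linear D -> D};
  oadj : {linear D -> D};
  oadjP : forall phi psi, dprod (oapp phi) psi = dprod phi (oadj psi)
}.

Lemma dprodC phi psi : dprod phi psi = (dprod psi phi)^*.
Proof. by rewrite /dprod hermC expr0 mul1r. Qed.

Lemma dprodDl phi1 phi2 psi :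
  dprod (phi1 + phi2) psi = dprod phi1 psi + dprod phi2 psi.
Proof. by rewrite /dprod linearD linearDl. Qed.

Lemma dprodZl c phi psi : dprod (c *: phi) psi = c * dprod phi psi.
Proof. by rewrite /dprod linearZ linearZl. Qed.

Lemma dprodDr phi psi1 psi2 :
  dprod phi (psi1 + psi2) = dprod phi psi1 + dprod phi psi2.
Proof. by rewrite dprodC dprodDl rmorphD /= -!dprodC. Qed.

Lemma dprodZr c phi psi : dprod phi (c *: psi) = c^* * dprod phi psi.
Proof. by rewrite dprodC dprodZl rmorphM /= -dprodC. Qed.

Fact odag_subproof (A : operator) phi psi :
  dprod (oadj A phi) psi = dprod phi (A psi).
Proof. by rewrite dprodC -oadjP -dprodC. Qed.

Definition odag (A : operator) := Operator (odag_subproof A).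

Fact oadd_subproof (A B : operator) phi psi :
  dprod ((A \+ B) phi) psi = dprod phi ((oadj A \+ oadj B) psi).
Proof. by rewrite /= dprodDl dprodDr !oadjP. Qed.

Definition oadd (A B : operator) := Operator (oadd_subproof A B).

Fact omul_subproof (A B : operator) phi psi :
  dprod ((A \o B) phi) psi = dprod phi ((oadj B \o oadj A) psi).
Proof. by rewrite /= !oadjP. Qed.

Definition omul (A B : operator) := Operator (omul_subproof A B).

Fact oscale_subproof c (A : operator) phi psi :
  dprod ((c \*: A) phi) psi = dprod phi ((c^* \*: oadj A) psi).
Proof. by rewrite /= dprodZl dprodZr conjCK oadjP. Qed.

Definition oscale c (A : operator) := Operator (oscale_subproof c A).

Fact ozero_subproof phi psi :
  dprod ((\0 : D -> D) phi) psi = dprod phi ((\0 : D -> D) psi).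
Proof. by rewrite /= /dprod !linear0 linear0l. Qed.

Definition ozero := Operator ozero_subproof.

Definition hermitian_op (A : operator) := odag A =1 A.

(* The Hermitian operators with Z = oRe Z + i oIm Z. *)
Definition oRe (Z : operator) := oscale 2^-1 (oadd Z (odag Z)).
Definition oIm (Z : operator) :=
  oscale (2 * 'i)^-1 (oadd Z (oscale (-1) (odag Z))).

Definition commutator (A B : D -> D) : D -> D :=
  fun psi => A (B psi) - B (A psi).

Definition commute_op (A B : D -> D) := forall psi, commutator A B psi = 0.

(* E = exp(i A): every vector of the domain is an analytic vector of A, and
   the exponential series converges to E in the norm of H. *)
Definition is_expi (A : D -> D) (E : operator) := forall psi : D,
  (exists M : R[i], forall N : nat,
     \sum_(n < N) `|dd_incl D (iter n A psi)| / n`!%:R <= M) /\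
  (fun N : nat => \sum_(n < N)
     ('i ^+ n / n`!%:R) *: dd_incl D (iter n A psi)) @ \oo
    --> (dd_incl D (E psi) : H).

End Operators.

Definition eta (R : realType) (n : nat) : 'M[R]_n :=
  \matrix_(i, j) if i == j then (if val i == 0%N then -1 else 1) else 0.

Definition box (R : realType) (H : hilbertSpace R) (D : denseDomain H)
    (X : 'I_10 -> operator D) (a : 'I_10) : D -> D :=
  fun psi => \sum_b \sum_c
    (eta R 10 b c)%:C *: commutator (X b) (commutator (X c) (X a)) psi.

Definition ikkt_solution (R : realType) (H : hilbertSpace R)
    (D : denseDomain H) (X : 'I_10 -> operator D) :=
  (forall a, hermitian_op (X a)) /\ (forall a psi, box X a psi = 0).

Definition fuzzy_cylinder (R : realType) (H : hilbertSpace R)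
    (D : denseDomain H) (U Y : operator D) (r xi : R) :=
  [/\ hermitian_op Y,
      forall psi, U (odag U psi) = (r ^+ 2)%:C *: psi,
      forall psi, odag U (U psi) = (r ^+ 2)%:C *: psi,
      forall psi, commutator U Y psi = xi%:C *: U psi &
      forall psi, commutator (odag U) Y psi = - xi%:C *: odag U psi].

Definition quantum_plane (R : realType) (H : hilbertSpace R)
    (D : denseDomain H) (P : 'I_2 -> operator D) (theta : 'M[R]_2) :=
  [/\ theta^T = - theta, theta \in unitmx,
      forall mu, hermitian_op (P mu) &
      forall mu nu psi,
        commutator (P mu) (P nu) psi = ('i * (theta mu nu)%:C) *: psi].

Section TwoCylinders.
Variable R : realType.
Implicit Types (theta : 'M[R]_2) (k : 'rV[R]_2).

Definition plane_phase (H : hilbertSpace R) (D : denseDomain H)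
    (P : 'I_2 -> operator D) k : D -> D :=
  fun psi => \sum_mu (k 0 mu)%:C *: P mu psi.

Definition kdot theta k : R :=
  \sum_mu \sum_mu' \sum_nu \sum_nu'
    theta mu mu' * theta nu nu' * eta R 2 mu' nu' * k 0 mu * k 0 nu.

(* The second condition is [k_i.X, k_j.X] = 0; it makes the phases
   exp(i k_i.X) commute, and holds in particular when all k_i agree. *)
Definition admissible theta (xi : 'I_2 -> R) (k : 'I_2 -> 'rV[R]_2) :=
  (forall i, kdot theta (k i) = - xi i ^+ 2) /\
  (forall i j, k i *m theta *m (k j)^T = 0).

(* X^4 + i X^5 = U_0 exp(i k_0.X), X^6 + i X^7 = U_1 exp(i k_1.X);
   E i stands for exp(i k_i.X). *)
Definition brane (H : hilbertSpace R) (D : denseDomain H)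
    (P Y U E : 'I_2 -> operator D) (a : 'I_10) : operator D :=
  match val a with
  | 0%N => P 0
  | 1%N => P 1
  | 2%N => Y 0
  | 3%N => Y 1
  | 4%N => oRe (omul (U 0) (E 0))
  | 5%N => oIm (omul (U 0) (E 0))
  | 6%N => oRe (omul (U 1) (E 1))
  | 7%N => oIm (omul (U 1) (E 1))
  | _ => ozero D
  end.

(* Coordinates on R^4 x T^2: the four non-compact ones x^0, ..., x^3 (two for
   the plane, two for the cylinders), then the angles y^0, y^1. *)
Definition coords := 'rV[R]_((2 + 2) + 2).

(* The semi-classical limit of [brane]: U_i ~ r_i exp(i y^i). *)
Definition brane_embedding (r : 'I_2 -> R) (k : 'I_2 -> 'rV[R]_2)
    (z : coords) : 'rV[R]_10 :=
  let x := lsubmx z in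
  let phase i := rsubmx z 0 i + \sum_mu k i 0 mu * lsubmx x 0 mu in
  \row_a match val a with
  | 0%N => lsubmx x 0 0
  | 1%N => lsubmx x 0 1
  | 2%N => rsubmx x 0 0
  | 3%N => rsubmx x 0 1
  | 4%N => r 0 * cos (phase 0)
  | 5%N => r 0 * sin (phase 0)
  | 6%N => r 1 * cos (phase 1)
  | 7%N => r 1 * sin (phase 1)
  | _ => 0
  end.

(* {x^mu, x^nu} = theta^{mu nu} and {x^(2+i), y^i} = xi_i. *)
Definition poisson_tensor theta (xi : 'I_2 -> R) : 'M[R]_((2 + 2) + 2) :=
  let Xi := diag_mx (\row_i xi i) in
  block_mx (block_mx theta 0 0 0) (col_mx 0 Xi) (row_mx 0 (- Xi)) 0.

(* Rows of the Jacobian are indexed by the coordinates of the domain, so that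
   this is d_A x^a Theta^{AB} d_B x^b. *)
Definition poisson_bracket (Theta : 'M[R]_((2 + 2) + 2))
    (x : coords -> 'rV[R]_10) (z : coords) : 'M[R]_10 :=
  ('J x z)^T *m Theta *m 'J x z.

(* X^a ~ x^a, with [X^a, X^b] / i ~ {x^a, x^b}.  For the solutions considered
   here both sides are affine in the X^c, respectively the x^c, so that the
   correspondence is exact and free of ordering ambiguities. *)
Definition quantizes (H : hilbertSpace R) (D : denseDomain H)
    (X : 'I_10 -> operator D) (x : coords -> 'rV[R]_10)
    (Theta : 'M[R]_((2 + 2) + 2)) :=
  exists (f : 'I_10 -> 'I_10 -> 'I_10 -> R) (t : 'I_10 -> 'I_10 -> R),
  forall a b,
    (forall psi, commutator (X a) (X b) psi =
       'i *: (\sum_c (f a b c)%:C *: X c psi + (t a b)%:C *: psi)) /\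
    (forall z, poisson_bracket Theta x z a b =
       \sum_c f a b c * x z 0 c + t a b).

(* x descends to an injective immersion of R^4 x T^2. *)
Definition embeds_R4_T2 (x : coords -> 'rV[R]_10) :=
  (forall z, differentiable x z /\ row_free ('J x z)) /\
  (forall z z', x z = x z' <->
     lsubmx z = lsubmx z' /\
     forall i, exists m : int, rsubmx z' 0 i - rsubmx z 0 i = m%:~R * (2 * pi)).

Definition induced_metric (x : coords -> 'rV[R]_10) (z : coords) :
    'M[R]_((2 + 2) + 2) :=
  'J x z *m eta R 10 *m ('J x z)^T.

(* G^{AB}, up to a positive conformal factor, which does not affect the
   signature. *)
Definition effective_metric (Theta : 'M[R]_((2 + 2) + 2))
    (x : coords -> 'rV[R]_10) (z : coords) : 'M[R]_((2 + 2) + 2) :=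
  Theta *m induced_metric x z *m Theta^T.

Definition minkowski_signature n (M : 'M[R]_n) :=
  exists2 S : 'M[R]_n, S \in unitmx & S *m M *m S^T = eta R n.

End TwoCylinders.

(* Main.v *)
Require Import Defs.
From HB Require Import structures.
From mathcomp Require Import all_boot all_order all_algebra.
From mathcomp Require Import sesquilinear complex.
From mathcomp Require Import all_classical all_reals all_analysis ring lra.
Import Order.TTheory GRing.Theory Num.Theory numFieldNormedType.Exports.
Local Open Scope complex_scope.
Local Open Scope ring_scope.

(** Since k_i.X commutes with k_j.X, the operators E_i = exp(i k_i.X) and their
adjoints commute with each other, and [X^mu, k_i.X] being a scalar gives
[X^mu, E_i] = - v_i^mu E_i with v_i = theta k_i.  The waves Z_i = U_i E_i are
therefore commuting normal operators and eigenvectors of ad X^0, ..., ad X^3, so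
that Box Z_i = (k_i.k_i + xi_i^2) Z_i = 0; unitarity of E_i plays no role.

On the geometric side the embedding is simple in the coordinates x^p and
phi_i = y^i + k_i.x, in which the Poisson tensor stays constant and the induced
metric is diag(eta, 1, 1, r_0^2, r_1^2).  The non-compact block of the effective
metric is then W diag(eta_2, r_0^2, r_1^2) W^T with W block triangular, hence
congruent to the four-dimensional eta. *)

(** * Operators on a dense domain *)

Section HilbertSpace.
Context (R : realType) (H : hilbertSpace R).
Set Implicit Arguments. Unset Strict Implicit.
Implicit Types x y : H.

Lemma hs_dotZl c x y : hs_dot H (c *: x) y = c * hs_dot H x y.
Proof. exact: linearZl_LR. Qed.

Lemma hs_dotBl x y z : hs_dot H (x - y) z = hs_dot H x z - hs_dot H y z.
Proof. exact: linearBl. Qed.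

(** Write [x = z + a *: y] with [z] orthogonal to [y]: then [|hs_dot H x y|] is [|a *: y| * |y|],
    and Pythagoras bounds [|a *: y|] by [|x|]. *)
Lemma cauchy_schwarz x y : `|hs_dot H x y| <= `|x| * `|y|.
Proof.
have [->|y0] := eqVneq y 0; first by rewrite linear0r !normr0 mulr0.
have yy0 : hs_dot H y y != 0 by rewrite dnorm_eq0.
pose a := hs_dot H x y / hs_dot H y y; pose z := x - a *: y.
have zy : hs_dot H z y = 0 by rewrite hs_dotBl hs_dotZl divfK // subrr.
have xE : hs_dot H x y = a * hs_dot H y y by rewrite divfK.
rewrite xE normrM hs_norm normrX normr_id expr2 mulrA ler_wpM2r // -normrZ.
rewrite -(@ler_pXn2r _ 2) ?nnegrE // -!hs_norm.
have -> : x = z + a *: y by rewrite subrK.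
by rewrite [leRHS]hnormDd ?lerDr ?dnorm_ge0 //= linearZr_LR /= zy mulr0.
Qed.

Lemma cvg_hs_dot (u : nat -> H) (l y : H) :
  (u @ \oo --> l)%classic ->
  ((fun N => hs_dot H (u N) y : R[i]^o) @ \oo --> (hs_dot H l y : R[i]^o))%classic.
Proof.
move=> ul; apply/cvgrPdist_lt => e e0.
(* The [+ 1] keeps the denominator positive when [y = 0]. *)
have d0 : 0 < e / (`|y| + 1) by rewrite divr_gt0 // ltr_wpDl.
have /cvgrPdist_lt/(_ _ d0) := ul; apply: filterS => N ulN.
rewrite -hs_dotBl (le_lt_trans (cauchy_schwarz _ _)) //.
apply: (@le_lt_trans _ _ (`|l - u N| * (`|y| + 1))).
  by rewrite ler_wpM2l // lerDl.
by rewrite -ltr_pdivlMr // ltr_wpDl.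
Qed.

End HilbertSpace.

(** * Uniqueness of adjoints and commutators with exponentials *)

Section Operators.
Context (R : realType) (H : hilbertSpace R) (D : denseDomain H).
Set Implicit Arguments. Unset Strict Implicit.
Implicit Types (A B C : operator D) (phi psi : D).

(** Testing against the difference itself gives it norm zero, and the inclusion of the domain is
    injective. *)
Lemma dprod_inj psi psi' :
  (forall phi, dprod psi phi = dprod psi' phi) -> psi = psi'.
Proof.
move=> e; apply/eqP; rewrite -subr_eq0; apply/eqP; apply: (@dd_inj _ _ D).
have /eqP : dprod (psi - psi') (psi - psi') = 0.
  by rewrite -scaleN1r dprodDl dprodZl e mulN1r subrr.
by rewrite /dprod dnorm_eq0 linear0 => /eqP.
Qed.

(** The adjoint is stored as data in [operator]; this is its uniqueness, which lets identities
    between operators be daggered. *)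
Lemma odag_eq A B : A =1 B -> odag A =1 odag B.
Proof.
move=> AB psi; apply: dprod_inj => phi.
by rewrite /= dprodC -oadjP AB oadjP -dprodC.
Qed.

(* Term by term, T A^n = A^n T + n s A^(n-1); the unbounded T is moved
   through the limit by pairing with the vectors of the domain. *)
Lemma expi_commutator A E (T : operator D) s :
  is_expi A E -> (forall psi, commutator T A psi = s *: psi) ->
  forall psi, commutator T E psi = ('i * s) *: E psi.
Proof.
move=> AE TA psi; apply/eqP; rewrite subr_eq; apply/eqP/dprod_inj => phi.
(* The partial sums stay in the domain, so that [T] can be applied to them; only their limit is
   taken in [H]. *)
pose S N psi : D := \sum_(n < N) ('i ^+ n / n`!%:R) *: iter n A psi.
have S_cvg psi' phi' : ((fun N => dprod (S N psi') phi' : R[i]^o) @ \oo -->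
    (dprod (E psi') phi' : R[i]^o))%classic.
  rewrite /dprod; apply: cvg_hs_dot; have [_] := AE psi'.
  apply: cvg_trans; apply: near_eq_cvg; apply: nearW => N.
  by rewrite /S linear_sum; apply: eq_bigr => n _; rewrite linearZ.
(* At [n = 0] the factor [n%:R] cancels the meaningless [n.-1]. *)
have TAn n psi' : T (iter n A psi') =
    iter n A (T psi') + (n%:R * s) *: iter n.-1 A psi'.
  elim: n => [|n IHn]; first by rewrite mul0r scale0r addr0.
  rewrite iterS; have /eqP := TA (iter n A psi'); rewrite subr_eq => /eqP ->.
  rewrite IHn linearD linearZ /= addrCA; congr (_ + _).
  case: n {IHn} => [|n]; first by rewrite /= mul0r scale0r addr0 mul1r.
  by rewrite /= -scalerDl -[n.+2%:R]natr1 mulrDl mul1r addrC.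
(* The derivative term lowers the degree by one, hence [S N.+1] on one side and [S N] on the
   other. *)
have TS N : T (S N.+1 psi) = S N.+1 (T psi) + ('i * s) *: S N psi.
  rewrite /S linear_sum /= (eq_bigr (fun n : 'I_N.+1 =>
    ('i ^+ n / n`!%:R) *: iter n A (T psi) +
    ('i ^+ n / n`!%:R * (n%:R * s)) *: iter n.-1 A psi)).
    rewrite big_split /=; congr (_ + _).
    rewrite big_ord_recl /= mul0r mulr0 scale0r add0r scaler_sumr.
    apply: eq_bigr => n _; rewrite scalerA; congr (_ *: _).
    rewrite /bump leq0n add1n factS natrM exprS; field.
    by rewrite nat1r !pnatr_eq0 -lt0n fact_gt0.
  by move=> n _; rewrite linearZ /= TAn scalerDr scalerA.
(* One sequence, two limits: first with [T] moved onto [phi] as its adjoint, then with [T] commuted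
   past the partial sum. *)
have lim1 : ((fun N => dprod (T (S N.+1 psi)) phi : R[i]^o) @ \oo -->
    (dprod (T (E psi)) phi : R[i]^o))%classic.
  under eq_fun do rewrite oadjP.
  by rewrite oadjP; have := S_cvg psi (oadj T phi); rewrite -cvg_shiftS.
have lim2 : ((fun N => dprod (T (S N.+1 psi)) phi : R[i]^o) @ \oo -->
    (dprod (('i * s) *: E psi + E (T psi)) phi : R[i]^o))%classic.
  under eq_fun do rewrite TS addrC dprodDl dprodZl.
  by rewrite dprodDl dprodZl; apply: cvgD;
    [apply: cvgMr; apply: S_cvg|have := S_cvg (T psi) phi; rewrite -cvg_shiftS].
exact: cvg_unique lim1 lim2.
Qed.

End Operators.

(** * Algebra of commutators, adjoints and Hermitian parts *)

Section Commutant.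
Context (R : realType) (H : hilbertSpace R) (D : denseDomain H).
Implicit Types (A B C E T U Z : operator D) (psi : D).
Set Implicit Arguments. Unset Strict Implicit.

Lemma commute_opP A B : commute_op A B <-> forall psi, A (B psi) = B (A psi).
Proof.
by split=> AB psi; apply/eqP; have /eqP := AB psi; rewrite /commutator subr_eq0.
Qed.

Lemma commute_op_sym A B : commute_op A B -> commute_op B A.
Proof. by move=> /commute_opP AB; apply/commute_opP => psi; rewrite AB. Qed.

Lemma commute_op_add A B C :
  commute_op A B -> commute_op A C -> commute_op A (oadd B C).
Proof.
move=> /commute_opP AB /commute_opP AC; apply/commute_opP => psi /=.
by rewrite linearD AB AC.
Qed.

Lemma commute_op_scale c A B : commute_op A B -> commute_op A (oscale c B).
Proof.
by move=> /commute_opP AB; apply/commute_opP => psi /=; rewrite linearZ AB.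
Qed.

Lemma commute_op_mul A B C :
  commute_op A B -> commute_op A C -> commute_op A (omul B C).
Proof.
move=> /commute_opP AB /commute_opP AC; apply/commute_opP => psi /=.
by rewrite AB AC.
Qed.

Lemma commute_op_dag A B : commute_op A B -> commute_op (odag A) (odag B).
Proof.
move=> /commute_opP AB; apply/commute_opP => psi.
exact: (odag_eq (A := omul B A) (B := omul A B) (fun phi => esym (AB phi)) psi).
Qed.

Lemma commute_op_dagr A B :
  hermitian_op A -> commute_op A B -> commute_op A (odag B).
Proof.
move=> hA /commute_op_dag/commute_opP AB; apply/commute_opP => psi.
by have := AB psi; rewrite !hA.
Qed.

Lemma hermitian_Re Z : hermitian_op (oRe Z).
Proof.
move=> psi /=; rewrite addrC; congr (_ *: _).
by rewrite fmorphV rmorphMn rmorph1.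
Qed.

Lemma hermitian_Im Z : hermitian_op (oIm Z).
Proof.
move=> psi /=; rewrite fmorphV rmorphM rmorphMn rmorph1 /= conjCi.
by rewrite rmorphN1 mulrN invrN scaleNr -scalerN opprD !scaleN1r opprK addrC.
Qed.

Lemma commute_op_Re A Z :
  commute_op A Z -> commute_op A (odag Z) -> commute_op A (oRe Z).
Proof. by move=> AZ AZd; apply/commute_op_scale/commute_op_add. Qed.

Lemma commute_op_Im A Z :
  commute_op A Z -> commute_op A (odag Z) -> commute_op A (oIm Z).
Proof.
by move=> AZ AZd; apply/commute_op_scale/commute_op_add => //;
  apply: commute_op_scale.
Qed.

(** Taking adjoints reverses the commutator, which flips the sign of the real eigenvalue. *)
Lemma commutator_dag T Z (c : R) : hermitian_op T ->
  (forall psi, commutator T Z psi = - c%:C *: Z psi) ->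
  forall psi, commutator T (odag Z) psi = c%:C *: odag Z psi.
Proof.
move=> hT TZ psi.
have TZ' : oadd (omul T Z) (oscale (-1) (omul Z T)) =1 oscale (- c%:C) Z.
  by move=> phi /=; rewrite -TZ scaleN1r.
have := odag_eq TZ' psi; rewrite /= rmorphN1 scaleN1r.
rewrite -[oadj T psi]/(odag T psi) -[oadj T _]/(odag T _) !hT.
rewrite rmorphN /= (_ : (c%:C)^* = c%:C); last by exact: conjc_real.
by move=> /(congr1 -%R); rewrite opprB scaleNr opprK.
Qed.

Lemma commutatorD T A B psi :
  commutator T (oadd A B) psi = commutator T A psi + commutator T B psi.
Proof. by rewrite /commutator /= linearD opprD addrACA. Qed.

Lemma commutatorZ T A c psi :
  commutator T (oscale c A) psi = c *: commutator T A psi.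
Proof. by rewrite /commutator /= linearZ -scalerBr. Qed.

(** With [commutator_Im], this is the operator form of differentiating cosine and sine: the
    Hermitian parts of an eigenvector of [ad T] are rotated into each other. *)
Lemma commutator_Re T Z (c : R) : hermitian_op T ->
  (forall psi, commutator T Z psi = - c%:C *: Z psi) ->
  forall psi, commutator T (oRe Z) psi = 'i *: ((- c)%:C *: oIm Z psi).
Proof.
move=> hT TZ psi; rewrite commutatorZ commutatorD TZ (commutator_dag hT TZ) /=.
rewrite !scalerDr !scalerA; congr (_ *: _ + _ *: _).
  rewrite rmorphN /=; field; exact: neq0Ci.
rewrite rmorphN /=; field; exact: neq0Ci.
Qed.

Lemma commutator_Im T Z (c : R) : hermitian_op T ->
  (forall psi, commutator T Z psi = - c%:C *: Z psi) ->
  forall psi, commutator T (oIm Z) psi = 'i *: (c%:C *: oRe Z psi).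
Proof.
move=> hT TZ psi; rewrite commutatorZ commutatorD commutatorZ TZ (commutator_dag hT TZ) /=.
have i2 : ('i : R[i]) * 'i = -1 by rewrite -expr2 sqrCi.
rewrite !scalerDr !scalerA; congr (_ *: _ + _ *: _).
  rewrite invfM invCi; ring.
rewrite invfM invCi; ring.
Qed.

Lemma commutator_mul T A B psi :
  commutator T (omul A B) psi = commutator T A (B psi) + A (commutator T B psi).
Proof. by rewrite /commutator /= linearB addrA subrK. Qed.

Lemma commutator_sym A B psi : commutator A B psi = - commutator B A psi.
Proof. by rewrite /commutator opprB. Qed.

Lemma commute_op_mul_dag A B C :
  commute_op A (odag B) -> commute_op A (odag C) -> commute_op A (odag (omul B C)).
Proof. by move=> cAB cAC; apply: (commute_op_mul cAC cAB). Qed.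

(** Up to the factor [c], [odag U] is the inverse of [U]. This reaches the adjoint even when [A] is
    not Hermitian, where [commute_op_dagr] does not apply. *)
Lemma commute_op_unitary_dag A U (c : R) : c != 0 ->
  (forall psi, U (odag U psi) = c%:C *: psi) ->
  (forall psi, odag U (U psi) = c%:C *: psi) ->
  commute_op A U -> commute_op A (odag U).
Proof.
move=> c0 UUd UdU /commute_opP AU; apply/commute_opP => psi.
have c0' : c%:C != 0 by rewrite (inj_eq (@complexI R)).
apply: (scalerI c0'); rewrite /=.
by rewrite -UdU -AU UUd linearZ linearZ.
Qed.

End Commutant.

(** * Geometry of the embedding *)

(* x^(lin p) = x^p, x^(cosx i) = r_i cos phi_i and x^(sinx i) = r_i sin phi_i. *)
Definition lin (p : 'I_(2 + 2)) : 'I_10 := @lshift (2 + 2) 6 p.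
Definition cosx (i : 'I_2) : 'I_10 := @rshift 4 6 (@inord 5 (i.*2)).
Definition sinx (i : 'I_2) : 'I_10 := @rshift 4 6 (@inord 5 (i.*2).+1).

(** Sorting the ten directions by their role allows both circles to be treated at once. *)
Variant index_view : 'I_10 -> Prop :=
  | IndexLin p : index_view (lin p)
  | IndexCos i : index_view (cosx i)
  | IndexSin i : index_view (sinx i)
  | IndexNull (a : 'I_10) of (7 < a)%N : index_view a.

Lemma ord2_ind (Q : 'I_2 -> Prop) : Q 0 -> Q 1 -> forall i, Q i.
Proof.
move=> Q0 Q1 [[|[|//]] lt_i].
  by rewrite (_ : Ordinal lt_i = 0) //; apply: val_inj.
by rewrite (_ : Ordinal lt_i = 1) //; apply: val_inj.
Qed.

Lemma ord22_ind (Q : 'I_(2 + 2) -> Prop) :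
  (forall i, Q (lshift 2 i)) -> (forall i, Q (rshift 2 i)) -> forall p, Q p.
Proof. by move=> Ql Qr p; rewrite -[p]fintype.splitK; case: (fintype.split p). Qed.

Lemma cosx_val (i : 'I_2) : cosx i = (4 + i.*2)%N :> nat.
Proof. by move: i; apply: ord2_ind; rewrite /= inordK. Qed.

Lemma sinx_val (i : 'I_2) : sinx i = (4 + (i.*2).+1)%N :> nat.
Proof. by move: i; apply: ord2_ind; rewrite /= inordK. Qed.

Lemma indexP a : index_view a.
Proof.
have [a7|a7] := ltnP 7 a; first exact: IndexNull.
have [a4|a4] := ltnP a 4.
  rewrite (_ : a = lin (Ordinal (a4 : (a < 2 + 2)%N))); last exact: val_inj.
  exact: IndexLin.
have [i [ai|ai]] : exists i : 'I_2, a = cosx i \/ a = sinx i.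
  case: a a7 a4 => [[|[|[|[|[|[|[|[|//]]]]]]]] lt_a] // _ _.
  - by exists 0; left; apply: val_inj; rewrite [RHS]cosx_val.
  - by exists 0; right; apply: val_inj; rewrite [RHS]sinx_val.
  - by exists 1; left; apply: val_inj; rewrite [RHS]cosx_val.
  - by exists 1; right; apply: val_inj; rewrite [RHS]sinx_val.
- by rewrite ai; apply: IndexCos.
- by rewrite ai; apply: IndexSin.
Qed.

Section PhaseTensor.
Context (R : realType) (theta : 'M[R]_2) (xi : 'I_2 -> R).
Context (k : 'I_2 -> 'rV[R]_2).

Definition waves : 'M[R]_2 := \matrix_i k i.
Definition Xi : 'M[R]_2 := diag_mx (\row_i xi i).

(* {x^p, phi_i}, where phi_i = y^i + k_i.x is the phase of the i-th circle. *)
Definition phase_bracket : 'M[R]_(2 + 2, 2) := col_mx (theta *m waves^T) Xi.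
Definition linear_bracket : 'M[R]_(2 + 2) := block_mx theta 0 0 0.

End PhaseTensor.

(** * An angle is determined modulo 2 pi by its cosine and sine *)

Section Trigo.
Context (R : realType).
Set Implicit Arguments. Unset Strict Implicit.

Lemma periodicz (f : R -> R) (T : R) : periodic f T ->
  forall (m : int) a, f (a + T *~ m) = f a.
Proof.
move=> fT [n|n] a; first by rewrite -pmulrn periodicn.
by rewrite NegzE -nmulrn -(periodicn fT n.+1) subrK.
Qed.

(** Reduce [t] to [s] in [0, 2 pi). The double-angle formula forces sin(s/2) = 0, whereas the sine
    is positive at s/2 if s is not 0. *)
Lemma cos_eq1 (t : R) : cos t = 1 -> exists m : int, t = m%:~R * (2 * pi).
Proof.
have pi2_gt0 : 0 < 2 * pi :> R by rewrite mulr_gt0 // pi_gt0.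
move=> ct; pose m := Num.floor (t / (2 * pi)); exists m.
pose s := t - m%:~R * (2 * pi).
have s_ge0 : 0 <= s by rewrite subr_ge0 -ler_pdivlMr // ge_floor.
have s_lt : s < 2 * pi.
  by rewrite ltrBlDl -[X in _ + X]mul1r -mulrDl -ltr_pdivrMr // -(intrD _ _ 1) floorD1_gt.
have cs : cos s = 1.
  rewrite -ct -(periodicz (@cosD2pi R) m s); congr cos.
  by rewrite -mulrzl -mulr_natl subrK.
have [s0|s_neq0] := eqVneq s 0; first by apply/eqP; rewrite -subr_eq0 -/s s0.
have : 0 < sin (s / 2).
  have s_gt0 : 0 < s by rewrite lt_def s_neq0.
  by apply: sin_gt0_pi; apply/andP; split; lra.
suff -> : sin (s / 2) = 0 by rewrite ltxx.
have := cos_mulr2n (s / 2).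
rewrite -[s / 2 *+ 2]mulr_natr divfK ?pnatr_eq0 // cs mulr2n => c2.
by apply/eqP; rewrite -sqrf_eq0; apply/eqP; have := cos2Dsin2 (s / 2); lra.
Qed.

Lemma cos_sin_inj (a b : R) : cos a = cos b -> sin a = sin b ->
  exists m : int, b - a = m%:~R * (2 * pi).
Proof.
move=> ca sa; apply: cos_eq1.
by rewrite cosB ca sa -!expr2 cos2Dsin2.
Qed.

End Trigo.

(** * Differential of the embedding in the coframe of the phases *)

Section Geometry.
Context (R : realType) (theta : 'M[R]_2) (r xi : 'I_2 -> R).
Context (k : 'I_2 -> 'rV[R]_2).
Set Implicit Arguments. Unset Strict Implicit.

(* The columns are the differentials of x^0, ..., x^3 and of the phases. *)
Definition coframe : 'M[R]_((2 + 2) + 2) :=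
  block_mx 1%:M (col_mx (waves k)^T 0) 0 1%:M.

Implicit Types z : coords R.

Notation x := (brane_embedding r k).

(** The change of variables from (x, y) to (x, phi) is linear, so the same matrix transforms points
    and differentials. *)
Lemma coframe_mul (z : coords R) : z *m coframe =
  row_mx (lsubmx z) (lsubmx (lsubmx z) *m (waves k)^T + rsubmx z).
Proof.
rewrite -{1}[z]hsubmxK mul_row_block !mulmx1 mulmx0 addr0.
by rewrite -{2}[lsubmx z]hsubmxK mul_row_col mulmx0 addr0.
Qed.

Lemma brane_embedding_lin z p : x z 0 (lin p) = (z *m coframe) 0 (lshift 2 p).
Proof.
rewrite coframe_mul row_mxEl mxE; move: p; apply: ord22_ind => i.
  rewrite -[in RHS](hsubmxK (lsubmx z)) row_mxEl.
  by move: i; apply: ord2_ind.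
rewrite -[in RHS](hsubmxK (lsubmx z)) row_mxEr.
by move: i; apply: ord2_ind.
Qed.

Lemma coframe_phase z i : (z *m coframe) 0 (rshift (2 + 2) i) =
  rsubmx z 0 i + \sum_mu k i 0 mu * lsubmx (lsubmx z) 0 mu.
Proof.
rewrite coframe_mul row_mxEr mxE addrC; congr (_ + _); rewrite mxE.
by apply: eq_bigr => mu _; rewrite !mxE mulrC.
Qed.

Lemma brane_embedding_cos z i :
  x z 0 (cosx i) = r i * cos ((z *m coframe) 0 (rshift (2 + 2) i)).
Proof.
by rewrite coframe_phase mxE [val _]cosx_val; move: i; apply: ord2_ind.
Qed.

Lemma brane_embedding_sin z i :
  x z 0 (sinx i) = r i * sin ((z *m coframe) 0 (rshift (2 + 2) i)).
Proof.
by rewrite coframe_phase mxE [val _]sinx_val; move: i; apply: ord2_ind.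
Qed.

Lemma brane_embedding_null z (a : 'I_10) : (7 < a)%N -> x z 0 a = 0.
Proof. by rewrite mxE; case: a => [[|[|[|[|[|[|[|[|a]]]]]]]] lt_a]. Qed.

(** A linear form is its own differential; differentiability is proved first, coordinate by
    coordinate, since it supplies the continuity that [diff_lin] requires. *)
Lemma is_diff_form n (v : 'cV[R]_n.+1) (z : 'rV[R]_n.+1) :
  is_diff z (fun w : 'rV[R]_n.+1 => (w *m v) 0 0) (fun w => (w *m v) 0 0).
Proof.
pose f : 'rV[R]_n.+1 -> R := fun w => (w *m v) 0 0.
have f_lin : linear f by move=> c y w; rewrite /f mulmxDl -scalemxAl !mxE.
pose fl := GRing.isLinear.Build _ _ _ _ f f_lin.
pose f' : {linear 'rV[R]_n.+1 -> R} := HB.pack f fl.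
have f_diff y : differentiable f y.
  have -> : f = \sum_(j < n.+1) (fun w : 'rV[R]_n.+1 => w 0 j * v j 0).
    by apply/funext => w; rewrite fct_sumE /f mxE.
  apply: differentiable_sum => j; apply: differentiableM.
    exact: differentiable_coord.
  exact: differentiable_cst.
have f_cont : continuous f by move=> y; exact: differentiable_continuous.
by apply: DiffDef; [exact: f_diff|exact: (@diff_lin _ _ _ f' z f_cont)].
Qed.

(* dx^a in the coframe dx^p, dphi_i. *)
Definition coord_diff z (a : 'I_10) : 'rV[R]_((2 + 2) + 2) :=
  match val a with
  | 0%N => delta_mx 0 (lshift 2 (lshift 2 0))
  | 1%N => delta_mx 0 (lshift 2 (lshift 2 1))
  | 2%N => delta_mx 0 (lshift 2 (rshift 2 0))
  | 3%N => delta_mx 0 (lshift 2 (rshift 2 1))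
  | 4%N => - x z 0 (sinx 0) *: delta_mx 0 (rshift (2 + 2) 0)
  | 5%N => x z 0 (cosx 0) *: delta_mx 0 (rshift (2 + 2) 0)
  | 6%N => - x z 0 (sinx 1) *: delta_mx 0 (rshift (2 + 2) 1)
  | 7%N => x z 0 (cosx 1) *: delta_mx 0 (rshift (2 + 2) 1)
  | _ => 0
  end.

Lemma coord_diff_lin z p : coord_diff z (lin p) = delta_mx 0 (lshift 2 p).
Proof.
by move: p; apply: ord22_ind; apply: ord2_ind.
Qed.

Lemma coord_diff_cos z i :
  coord_diff z (cosx i) = - x z 0 (sinx i) *: delta_mx 0 (rshift (2 + 2) i).
Proof. by rewrite /coord_diff [val _]cosx_val; move: i; apply: ord2_ind. Qed.

Lemma coord_diff_sin z i :
  coord_diff z (sinx i) = x z 0 (cosx i) *: delta_mx 0 (rshift (2 + 2) i).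
Proof. by rewrite /coord_diff [val _]sinx_val; move: i; apply: ord2_ind. Qed.

Lemma coord_diff_null z (a : 'I_10) : (7 < a)%N -> coord_diff z a = 0.
Proof.
by rewrite /coord_diff; case: a => [[|[|[|[|[|[|[|[|a]]]]]]]] lt_a].
Qed.

Definition frame_diff z : 'M[R]_(10, (2 + 2) + 2) := \matrix_a coord_diff z a.

Lemma row_frame_diff z a : row a (frame_diff z) = coord_diff z a.
Proof. exact: rowK. Qed.

(** Chain rule: each coordinate is zero, a linear form in [z *m coframe], or [r i] times the cosine
    or sine of one. *)
Lemma is_diff_coord z a : is_diff z (fun w => x w 0 a)
  (fun w => (w *m coframe *m (coord_diff z a)^T) 0 0).
Proof.
have form A : is_diff z (fun w : coords R => (w *m coframe) 0 A)
    (fun w : coords R => (w *m coframe) 0 A).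
  have -> : (fun w : coords R => (w *m coframe) 0 A) =
      (fun w => (w *m col A coframe) 0 0).
    by apply/funext => w; rewrite colE mulmxA -colE [RHS]mxE.
  exact: is_diff_form.
have delta (w : coords R) A :
     (w *m coframe *m (delta_mx 0 A : 'rV[R]_(2 + 2 + 2))^T) 0 0 =
    (w *m coframe) 0 A.
  by rewrite trmx_delta -colE [LHS]mxE.
case: (indexP a) => [p|i|i|{}a a7].
- rewrite (_ : (fun w => x w 0 (lin p)) = fun w => (w *m coframe) 0 (lshift 2 p)).
    apply: (is_diff_eq (form _)); apply/funext => w.
    by rewrite coord_diff_lin delta.
  by apply/funext => w; rewrite brane_embedding_lin.
- rewrite (_ : (fun w => x w 0 (cosx i)) =
      r i *: (cos \o (fun w : coords R => (w *m coframe) 0 (rshift (2 + 2) i)))).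
    have dcos (t : R) : is_diff t cos ( *:%R^~ (- sin t)).
      apply: DiffDef; first exact/derivable1_diffP.
      by rewrite diff1E ?derive1E ?derive_val //; exact/derivable1_diffP.
    apply: (is_diff_eq (is_diffZ (r i) (is_diff_comp (form _) (dcos _)))).
    apply/funext => w /=; rewrite coord_diff_cos linearZ /= -scalemxAr [RHS]mxE delta.
    rewrite brane_embedding_sin; set t := (z *m _) 0 _; set dt := (w *m _) 0 _.
    by transitivity (r i * (dt * - sin t)) => //; ring.
  by apply/funext => w; rewrite brane_embedding_cos.
- rewrite (_ : (fun w => x w 0 (sinx i)) =
      r i *: (sin \o (fun w : coords R => (w *m coframe) 0 (rshift (2 + 2) i)))).
    have dsin (t : R) : is_diff t sin ( *:%R^~ (cos t)).
      apply: DiffDef; first exact/derivable1_diffP.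
      by rewrite diff1E ?derive1E ?derive_val //; exact/derivable1_diffP.
    apply: (is_diff_eq (is_diffZ (r i) (is_diff_comp (form _) (dsin _)))).
    apply/funext => w /=; rewrite coord_diff_sin linearZ /= -scalemxAr [RHS]mxE delta.
    rewrite brane_embedding_cos; set t := (z *m _) 0 _; set dt := (w *m _) 0 _.
    by transitivity (r i * (dt * cos t)) => //; ring.
  by apply/funext => w; rewrite brane_embedding_sin.
- rewrite (_ : (fun w => x w 0 a) = cst 0).
    apply: (is_diff_eq (is_diff_cst _ _)); apply/funext => w.
    by rewrite coord_diff_null // trmx0 mulmx0 mxE.
  by apply/funext => w; rewrite brane_embedding_null.
Qed.

Lemma differentiable_brane z : differentiable x z.
Proof.
have -> : x = \sum_(a < 10) (fun w => x w 0 a *: delta_mx 0 a).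
  by apply/funext => w; rewrite fct_sumE; exact: row_sum_delta.
apply: differentiable_sum => a; apply: differentiableZl.
exact: (@ex_diff _ _ _ _ _ _ _ (is_diff_coord z a)).
Qed.

(** Column [a] is the differential of x^a: composing the total differential with the [a]-th
    coordinate form must give back [is_diff_coord]. *)
Lemma jacobian_brane z : 'J x z = coframe *m (frame_diff z)^T.
Proof.
apply/matrixP => A a; rewrite mxE.
have dx : is_diff z x ('d x z) by apply/differentiableP/differentiable_brane.
have ca := is_diff_comp dx (is_diff_form (delta_mx a 0) (x z)).
have := @diff_val _ _ _ _ _ _ _ ca.
rewrite (_ : _ \o x = fun w => x w 0 a); last first.
  by apply/funext => w; rewrite /= -colE mxE.
rewrite (@diff_val _ _ _ _ _ _ _ (is_diff_coord z a)).
move/(congr1 (fun f => f (delta_mx 0 A))) => /=; rewrite -colE [RHS]mxE => <-.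
by rewrite -rowE [LHS]mxE [RHS]mxE; apply: eq_bigr => B _; rewrite !mxE.
Qed.

Lemma mulmx_row_entry m n p q (A : 'M[R]_(m, n)) (M : 'M[R]_(n, p))
    (B : 'M[R]_(q, p)) a b :
  (A *m M *m B^T) a b = (row a A *m M *m (row b B)^T) 0 0.
Proof.
by rewrite -row_mul [LHS]mxE [RHS]mxE; apply: eq_bigr => c _;
  rewrite ![_^T _ _]mxE ![row _ _ _ _]mxE.
Qed.

Lemma delta_mul_entry m n (M : 'M[R]_(m, n)) i j :
  ((delta_mx 0 i : 'rV[R]_m) *m M *m (delta_mx 0 j : 'rV[R]_n)^T) 0 0 = M i j.
Proof. by rewrite trmx_delta -rowE -colE !mxE. Qed.

(** * Poisson brackets of the embedding functions *)

Hypothesis theta_anti : theta^T = - theta.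
Hypothesis adm : admissible theta xi k.

Notation Theta := (poisson_tensor theta xi).
Notation alpha := (phase_bracket theta xi k).
Notation K := (waves k).

Lemma poisson_tensor_anti : Theta^T = - Theta.
Proof.
rewrite /poisson_tensor !tr_block_mx tr_col_mx tr_row_mx !trmx0 theta_anti.
by rewrite !opp_block_mx opp_col_mx opp_row_mx !oppr0 linearN /= tr_diag_mx opprK.
Qed.

Lemma waves_theta_waves : K *m theta *m K^T = 0.
Proof.
apply/matrixP => i j; rewrite mulmx_row_entry !rowK.
by have [_ ->] := adm; rewrite !mxE.
Qed.

Lemma tensor_coframe : Theta *m coframe =
  block_mx (linear_bracket theta) alpha (row_mx 0 (- Xi xi)) 0.
Proof.
rewrite /poisson_tensor /coframe mulmx_block !mulmx1 ?mulmx0 ?addr0.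
rewrite mul_row_col mul0mx mulmx0 addr0; congr block_mx.
by rewrite mul_block_col ?mul0mx ?addr0 add_col_mx add0r addr0.
Qed.

(** The lower right block holds the brackets {phi_i, phi_j} = k_i theta k_j^T, which the second
    admissibility condition makes zero. *)
Lemma coframe_tensor_coframe : coframe^T *m Theta *m coframe =
  block_mx (linear_bracket theta) alpha (- alpha^T) 0.
Proof.
rewrite -mulmxA tensor_coframe /coframe tr_block_mx !trmx1 !trmx0 tr_col_mx trmxK.
rewrite mulmx_block !mul1mx ?mul0mx ?mulmx0 ?addr0 mul_row_block mul_row_col.
rewrite mulmxA waves_theta_waves ?mul0mx ?mulmx0 ?addr0 add_row_mx add0r addr0.
rewrite tr_col_mx trmx_mul trmxK theta_anti mulmxN tr_diag_mx opp_row_mx opprK.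
by rewrite trmx0 mul0mx addr0.
Qed.

Lemma poisson_bracketE z a b : poisson_bracket Theta x z a b =
  (coord_diff z a *m block_mx (linear_bracket theta) alpha (- alpha^T) 0 *m
     (coord_diff z b)^T) 0 0.
Proof.
rewrite /poisson_bracket jacobian_brane trmx_mul trmxK.
rewrite -!mulmxA (mulmxA _ _ (frame_diff z)^T) (mulmxA _ _ (frame_diff z)^T).
rewrite (mulmxA coframe^T).
rewrite coframe_tensor_coframe (mulmxA (frame_diff z)) [LHS]mulmx_row_entry.
by rewrite !row_frame_diff mulmxA.
Qed.

Lemma poisson_bracket_anti z a b :
  poisson_bracket Theta x z a b = - poisson_bracket Theta x z b a.
Proof.
have : (poisson_bracket Theta x z)^T = - poisson_bracket Theta x z.
  by rewrite /poisson_bracket !trmx_mul trmxK poisson_tensor_anti mulNmx mulmxN mulmxA.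
by move=> /(congr1 (fun M : 'M[R]_10 => M b a)); rewrite [LHS]mxE [RHS]mxE.
Qed.

Lemma bracket_coord_coord z p q :
  poisson_bracket Theta x z (lin p) (lin q) = linear_bracket theta p q.
Proof. by rewrite poisson_bracketE !coord_diff_lin delta_mul_entry block_mxEul. Qed.

Lemma bracket_coord_cos z p i :
  poisson_bracket Theta x z (lin p) (cosx i) = - alpha p i * x z 0 (sinx i).
Proof.
rewrite poisson_bracketE coord_diff_lin coord_diff_cos linearZ /= -scalemxAr mxE.
by rewrite delta_mul_entry block_mxEur; ring.
Qed.

Lemma bracket_coord_sin z p i :
  poisson_bracket Theta x z (lin p) (sinx i) = alpha p i * x z 0 (cosx i).
Proof.
rewrite poisson_bracketE coord_diff_lin coord_diff_sin linearZ /= -scalemxAr mxE.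
by rewrite delta_mul_entry block_mxEur; ring.
Qed.

(** All these coordinates have differentials proportional to some dphi_i, and the phases
    Poisson-commute. *)
Lemma bracket_circles z (a b : 'I_10) : (3 < a)%N -> (3 < b)%N ->
  poisson_bracket Theta x z a b = 0.
Proof.
have cd (c : 'I_10) : (3 < c)%N ->
    exists s (i : 'I_2), coord_diff z c = s *: delta_mx 0 (rshift (2 + 2) i).
  case: (indexP c) => [p|i|i|{}c c7] c3.
  - by move: c3; rewrite ltnNge -ltnS (ltn_ord p).
  - by rewrite coord_diff_cos; do 2!eexists.
  - by rewrite coord_diff_sin; do 2!eexists.
  - by exists 0, 0; rewrite coord_diff_null // scale0r.
move=> /cd[s [i ea]] /cd[t [j eb]]; rewrite poisson_bracketE ea eb.
rewrite linearZ /= -scalemxAr -!scalemxAl mxE [X in _ * X]mxE delta_mul_entry.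
by rewrite block_mxEdr !mxE !mulr0.
Qed.

(** * Induced metric, embedding property and effective metric *)

Hypothesis r_gt0 : forall i, 0 < r i.
Hypothesis xi_neq0 : forall i, xi i != 0.
Hypothesis theta_unit : theta \in unitmx.

Lemma sum_index (V : zmodType) (f : 'I_10 -> V) :
  (forall a : 'I_10, (7 < a)%N -> f a = 0) ->
  \sum_a f a = \sum_p f (lin p) + \sum_i (f (cosx i) + f (sinx i)).
Proof.
move=> f0; rewrite (@big_split_ord _ _ _ (2 + 2) 6) /=; congr (_ + _).
rewrite !big_ord_recl !big_ord0 !addr0 !addrA.
rewrite [X in _ + X]f0 // addr0 [X in _ + X]f0 // addr0.
by congr (f _ + f _ + f _ + f _); apply: val_inj; rewrite /= inordK.
Qed.

Lemma eta_diag n : Defs.eta R n = diag_mx (\row_i Defs.eta R n i i).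
Proof.
by apply/matrixP => i j; rewrite !mxE; case: eqVneq => [->|]; rewrite ?mulr1n ?mulr0n ?eqxx.
Qed.

Definition phase_metric : 'M[R]_((2 + 2) + 2) :=
  block_mx (block_mx (Defs.eta R 2) 0 0 1%:M) 0 0 (diag_mx (\row_i r i ^+ 2)).

Lemma eta_block : Defs.eta R (2 + 2) = block_mx (Defs.eta R 2) 0 0 1%:M.
Proof.
apply/matrixP; apply: ord22_ind => i; apply: ord22_ind => j.
- by rewrite block_mxEul !mxE eq_shift.
- by rewrite block_mxEur !mxE eq_shift.
- by rewrite block_mxEdl !mxE eq_shift.
- by rewrite block_mxEdr !mxE eq_shift; case: eqP.
Qed.

Lemma phase_metricE : phase_metric =
  diag_mx (row_mx (\row_p Defs.eta R 10 (lin p) (lin p)) (\row_i r i ^+ 2)).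
Proof.
rewrite diag_mx_row /phase_metric; congr block_mx.
by rewrite -eta_block eta_diag; congr diag_mx; apply/rowP => p; rewrite !mxE !eqxx.
Qed.

Lemma eta_cos i : Defs.eta R 10 (cosx i) (cosx i) = 1.
Proof. by rewrite mxE eqxx [val _]cosx_val. Qed.

Lemma eta_sin i : Defs.eta R 10 (sinx i) (sinx i) = 1.
Proof. by rewrite mxE eqxx [val _]sinx_val. Qed.

(** Each circle contributes r_i^2 (sin^2 + cos^2) dphi_i^2, so the dependence on the base point
    disappears. *)
Lemma frame_metric z :
  (frame_diff z)^T *m Defs.eta R 10 *m frame_diff z = phase_metric.
Proof.
rewrite (eta_diag 10) diag_mx_sum_delta mulmx_sumr mulmx_suml.
have -> : \sum_a (frame_diff z)^T *m
      ((\row_b Defs.eta R 10 b b) 0 a *: delta_mx a a) *m frame_diff z =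
    \sum_a Defs.eta R 10 a a *: ((coord_diff z a)^T *m coord_diff z a).
  apply: eq_bigr => a _; rewrite [(\row__ _) _ _]mxE -scalemxAr -scalemxAl.
  rewrite -(mul_delta_mx (0 : 'I_1)) -mulmxA -mulmxA -rowE mulmxA.
  by rewrite -[_ *m delta_mx _ _]trmxK trmx_mul trmxK trmx_delta -rowE row_frame_diff.
rewrite sum_index => [|a a7]; last by rewrite coord_diff_null // mulmx0 scaler0.
rewrite phase_metricE diag_mx_sum_delta [RHS]big_split_ord /=; congr (_ + _).
  apply: eq_bigr => p _; rewrite coord_diff_lin trmx_delta mul_delta_mx.
  by rewrite row_mxEl [in RHS]mxE.
apply: eq_bigr => i _; rewrite coord_diff_cos coord_diff_sin row_mxEr !linearZ /=.
rewrite -?scalemxAl -?scalemxAr trmx_delta mul_delta_mx !scalerA -scalerDl.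
rewrite eta_cos eta_sin brane_embedding_cos brane_embedding_sin [in RHS]mxE.
congr (_ *: _); set t := (z *m coframe) 0 _.
by rewrite -[RHS]mulr1 -[X in _ = _ * X](cos2Dsin2 t); ring.
Qed.

Lemma induced_metricE z :
  induced_metric x z = coframe *m phase_metric *m coframe^T.
Proof.
rewrite /induced_metric jacobian_brane trmx_mul trmxK -(frame_metric z).
by rewrite !mulmxA.
Qed.

Lemma coframe_unit : coframe \in unitmx.
Proof. by rewrite unitmxE det_ublock !det1 mulr1 unitr1. Qed.

Lemma diag_unit (d : 'I_2 -> R) : (forall i, d i != 0) ->
  diag_mx (\row_i d i) \in unitmx.
Proof.
move=> d0; rewrite unitmxE det_diag unitfE; apply/prodf_neq0 => i _.
by rewrite mxE.
Qed.

Lemma eta_sqr n : Defs.eta R n *m Defs.eta R n = 1%:M.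
Proof.
rewrite eta_diag mulmx_diag -diag_const_mx; congr diag_mx; apply/rowP => i.
by rewrite !mxE eqxx; case: ifP; rewrite ?mulrNN mulr1.
Qed.

Lemma phase_metric_unit : phase_metric \in unitmx.
Proof.
rewrite unitmxE det_ublock -eta_block unitrM -!unitmxE.
rewrite (mulmx1_unit (eta_sqr _)).1 /=; apply: diag_unit => i.
by rewrite sqrf_eq0 gt_eqF.
Qed.

Lemma brane_immersion z : row_free ('J x z).
Proof.
apply/row_freeP; have := coframe_unit; have := phase_metric_unit => Nu Fu.
(* [frame_metric] turns the non-degeneracy of the induced metric into this right inverse of the
   Jacobian. *)
exists (Defs.eta R 10 *m frame_diff z *m invmx phase_metric *m invmx coframe).
rewrite jacobian_brane !mulmxA -!(mulmxA coframe) frame_metric mulmxV // mul1mx.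
exact: mulmxV.
Qed.

Lemma poisson_tensor_unit : Theta \in unitmx.
Proof.
have Xu : Xi xi \in unitmx by apply: diag_unit.
(* Inverse block by block: [theta] on the plane, and an antisymmetric pairing of x^(2+i) with y^i
   whose sign flips under inversion. *)
pose Theta' : 'M[R]_((2 + 2) + 2) := block_mx (block_mx (invmx theta) 0 0 0)
  (col_mx 0 (- invmx (Xi xi))) (row_mx 0 (invmx (Xi xi))) 0.
suff /mulmx1_unit[] : Theta *m Theta' = 1%:M by [].
rewrite mulmx_block mulmx_block mul_col_row mul_block_col mul_row_block mul_row_col.
rewrite ?mul0mx ?mulmx0 ?addr0 ?add0r mulmxV // -/(Xi xi).
rewrite mulmxV // mulNmx mulmxN opprK mulmxV //.
by rewrite add_block_mx ?addr0 ?add0r col_mx0 row_mx0 -!scalar_mx_block.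
Qed.

Lemma brane_embeds : embeds_R4_T2 x.
Proof.
split=> [z|z z']; first by split; [exact: differentiable_brane|exact: brane_immersion].
split=> [xz|[zl zr]].
  have xa a : x z 0 a = x z' 0 a by rewrite xz.
  have zl : lsubmx z = lsubmx z'.
    apply/rowP => p; have := xa (lin p).
    by rewrite !brane_embedding_lin !coframe_mul !row_mxEl.
  (* The cosine and sine fix the phase modulo 2 pi; as the k_i.x already agree, the same holds for
     y^i. *)
  split=> // i; have := xa (sinx i); have := xa (cosx i).
  rewrite !brane_embedding_cos !brane_embedding_sin.
  have r0 : r i != 0 by rewrite gt_eqF.
  move=> /(mulfI r0) c /(mulfI r0) /(cos_sin_inj c)[m].
  rewrite !coframe_phase zl => e; exists m; rewrite -e; ring.
apply/rowP => a; have ph i : exists m : int, (z' *m coframe) 0 (rshift (2 + 2) i) =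
    (z *m coframe) 0 (rshift (2 + 2) i) + (pi *+ 2) *~ m.
  have [m e] := zr i; exists m; rewrite !coframe_phase zl -mulrzl -mulr_natl -e; ring.
case: (indexP a) => [p|i|i|{}a a7].
- by rewrite !brane_embedding_lin !coframe_mul !row_mxEl zl.
- have [m e] := ph i.
  by rewrite !brane_embedding_cos e (periodicz (@cosD2pi R)).
- have [m e] := ph i.
  by rewrite !brane_embedding_sin e (periodicz (@sinD2pi R)).
- by rewrite !brane_embedding_null.
Qed.

(** The non-compact rows of [Theta *m coframe] without the zero columns of dx^2 and dx^3: the
    brackets of x^p with x^0, x^1, phi_0 and phi_1. *)
Definition noncompact_frame : 'M[R]_(2 + 2) := block_mx theta (theta *m K^T) 0 (Xi xi).

(** No x^p has a bracket with x^2 or x^3, so their part of the induced metric drops out, and the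
    circles with weights r_i^2 take its place. *)
Lemma effective_metric_noncompact z :
  ulsubmx (effective_metric Theta x z) = noncompact_frame *m
    block_mx (Defs.eta R 2) 0 0 (diag_mx (\row_i r i ^+ 2)) *m noncompact_frame^T.
Proof.
rewrite /effective_metric induced_metricE.
have -> : Theta *m (coframe *m phase_metric *m coframe^T) *m Theta^T =
    (Theta *m coframe) *m phase_metric *m (Theta *m coframe)^T.
  by rewrite trmx_mul !mulmxA.
rewrite tensor_coframe tr_block_mx !mulmx_block block_mxKul.
rewrite /noncompact_frame !tr_block_mx !mulmx_block.
rewrite !trmx0 ?mul0mx ?mulmx0 ?addr0 ?add0r.
rewrite /phase_bracket mul_col_mx tr_col_mx mul_col_row mulmx_block add_block_mx.
by rewrite ?mul0mx ?mulmx0 ?addr0 ?add0r.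
Qed.

Lemma noncompact_minkowski z :
  minkowski_signature (ulsubmx (effective_metric Theta x z) : 'M[R]_(2 + 2)).
Proof.
pose N : 'M[R]_(2 + 2) := block_mx (Defs.eta R 2) 0 0 (diag_mx (\row_i r i ^+ 2)).
pose B : 'M[R]_(2 + 2) := block_mx 1%:M 0 0 (diag_mx (\row_i (r i)^-1)).
have r0 i : r i != 0 by rewrite gt_eqF.
have Wu : noncompact_frame \in unitmx.
  rewrite unitmxE det_ublock unitrM -!unitmxE theta_unit.
  exact: diag_unit.
have Bu : B \in unitmx.
  rewrite unitmxE det_ublock det1 mul1r -unitmxE.
  by apply: (diag_unit (d := fun i => (r i)^-1)) => i; rewrite invr_eq0.
(* Undo the frame, then rescale the two circle directions by 1 / r_i. *)
exists (B *m invmx noncompact_frame); first by rewrite unitmx_mul Bu unitmx_inv.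
rewrite effective_metric_noncompact -/N.
have -> : B *m invmx noncompact_frame *m
    (noncompact_frame *m N *m noncompact_frame^T) *m (B *m invmx noncompact_frame)^T =
    B *m N *m B^T.
  rewrite trmx_mul trmx_inv !mulmxA mulmxKV // -!mulmxA.
  by rewrite (mulmxA _^T (invmx _)) mulmxV ?unitmx_tr // mul1mx.
rewrite eta_block tr_block_mx !mulmx_block !trmx0 !trmx1 tr_diag_mx.
rewrite ?mul0mx ?mulmx0 ?addr0 ?add0r ?mul1mx ?mulmx1 ?mul0mx ?mulmx0 ?addr0 ?add0r.
congr block_mx; rewrite !mulmx_diag -diag_const_mx; congr diag_mx.
by apply/rowP => i; rewrite !mxE; field.
Qed.

End Geometry.

(** * Existence of admissible wave vectors *)

Section WaveVectors.
Context (R : realType) (theta : 'M[R]_2).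
Hypothesis theta_anti : theta^T = - theta.

Lemma antisymmetric_entry mu nu : theta mu nu = - theta nu mu.
Proof.
by have := congr1 (fun M : 'M[R]_2 => M nu mu) theta_anti; rewrite !mxE.
Qed.

(** This is the Minkowski square of [k *m theta], a vector that can be prescribed freely when
    [theta] is invertible. *)
Lemma kdotE (k : 'rV[R]_2) :
  kdot theta k = - (k *m theta) 0 0 ^+ 2 + (k *m theta) 0 1 ^+ 2.
Proof.
have th0 mu : theta mu mu = 0 by have := antisymmetric_entry mu mu; lra.
rewrite /kdot !mxE !big_ord_recl !big_ord0 !mxE /=.
rewrite (_ : lift ord0 ord0 = 1); last exact: val_inj.
rewrite (_ : ord0 = 0); last exact: val_inj.
by rewrite !th0 (antisymmetric_entry 1 0) /=; ring.
Qed.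

(* Two vectors of the plane with vanishing theta-pairing are parallel, so the
   solutions are k_i = +- xi_i kappa with kappa.kappa = -1. *)
Lemma admissible_exists (xi : 'I_2 -> R) : theta \in unitmx ->
  exists k : 'I_2 -> 'rV[R]_2, admissible theta xi k.
Proof.
move=> theta_unit.
(* Prescribing the unit time-like vector gives kappa.kappa = -1. *)
have [kappa kappaE] : exists kappa : 'rV[R]_2, kappa *m theta = delta_mx 0 0.
  by exists (delta_mx 0 0 *m invmx theta); rewrite mulmxKV.
exists (fun i => xi i *: kappa); split=> [i|i j].
  by rewrite kdotE -!scalemxAl kappaE !mxE /=; ring.
rewrite -!scalemxAl linearZ /= -scalemxAr; set s := _ *m kappa^T.
suff -> : s = 0 by rewrite !scaler0.
(* An antisymmetric 1 by 1 matrix vanishes. *)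
have sT : s^T = - s by rewrite /s !trmx_mul trmxK theta_anti mulNmx mulmxN mulmxA.
apply/matrixP => a b; rewrite !ord1 [RHS]mxE.
have := congr1 (fun M : 'M[R]_1 => M 0 0) sT; rewrite [LHS]mxE [RHS]mxE => s0.
lra.
Qed.

End WaveVectors.

(** * The matrix configuration *)

Section Brane.
Context (R : realType) (H : hilbertSpace R) (D : denseDomain H).
Context (theta : 'M[R]_2) (P : 'I_2 -> operator D).
Context (r xi : 'I_2 -> R) (U Y E : 'I_2 -> operator D).
Context (k : 'I_2 -> 'rV[R]_2).
Set Implicit Arguments. Unset Strict Implicit.

Implicit Types (A B T Z : operator D) (psi phi : D).

Notation V := (theta *m (waves k)^T).
Notation alpha := (phase_bracket theta xi k).

Definition coord_op (p : 'I_(2 + 2)) : operator D :=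
  match fintype.split p with inl mu => P mu | inr i => Y i end.

Definition circle_op (i : 'I_2) : operator D := omul (U i) (E i).

Notation X := (brane P Y U E).

Lemma brane_lin p : X (lin p) = coord_op p.
Proof.
move: p; apply: ord22_ind => i; rewrite /coord_op;
  [rewrite (unsplitK (inl i))|rewrite (unsplitK (inr i))];
  by move: i; apply: ord2_ind.
Qed.

Lemma brane_cos i : X (cosx i) = oRe (circle_op i).
Proof. by rewrite /brane [val _]cosx_val; move: i; apply: ord2_ind. Qed.

Lemma brane_sin i : X (sinx i) = oIm (circle_op i).
Proof. by rewrite /brane [val _]sinx_val; move: i; apply: ord2_ind. Qed.

Lemma brane_null (a : 'I_10) : (7 < a)%N -> X a = ozero D.
Proof.
by rewrite /brane; case: a => [[|[|[|[|[|[|[|[|a]]]]]]]] lt_a].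
Qed.

Hypothesis plane : quantum_plane P theta.
Hypothesis r_gt0 : forall i, 0 < r i.
Hypothesis cylinder : forall i, fuzzy_cylinder (U i) (Y i) (r i) (xi i).
Hypothesis plane_cylinder : forall mu i,
  commute_op (P mu) (U i) /\ commute_op (P mu) (Y i).
Hypothesis cylinder_cylinder : forall i j, i != j ->
  [/\ commute_op (U i) (U j), commute_op (U i) (Y j) &
      commute_op (Y i) (Y j)].
Hypothesis adm : admissible theta xi k.
Hypothesis expE : forall i, is_expi (plane_phase P (k i)) (E i).

Let hermP mu : hermitian_op (P mu). Proof. by case: plane. Qed.
Let hermY i : hermitian_op (Y i). Proof. by case: (cylinder i). Qed.

(** [plane_phase] as an [operator], so that it carries an adjoint and can enter
    [expi_commutator]. *)
Definition phase_op i : operator D :=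
  oadd (oscale (k i 0 0)%:C (P 0)) (oscale (k i 0 1)%:C (P 1)).

Lemma is_expi_phase_op i : is_expi (phase_op i) (E i).
Proof.
have -> : (phase_op i : D -> D) = plane_phase P (k i); last exact: expE.
by apply/funext => psi; rewrite /plane_phase !big_ord_recl big_ord0 addr0 /=
  (_ : lift ord0 ord0 = 1) //; apply: val_inj.
Qed.

Lemma hermitian_phase i : hermitian_op (phase_op i).
Proof.
by move=> psi /=; rewrite -[oadj (P _) _]/(odag (P _) _) hermP
  -[oadj (P 1) _]/(odag (P 1) _) hermP; congr (_ *: _ + _ *: _);
  exact: conjc_real.
Qed.

Lemma commute_op_phase A i : (forall mu, commute_op A (P mu)) ->
  commute_op A (phase_op i).
Proof. by move=> AP; apply: commute_op_add; apply: commute_op_scale. Qed.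

(** The case s = 0 of [expi_commutator]. *)
Lemma commute_op_phase_expi A i : commute_op A (phase_op i) -> commute_op A (E i).
Proof.
move=> AA psi; rewrite (@expi_commutator _ _ _ _ _ _ 0 (is_expi_phase_op i)).
  by rewrite mulr0 scale0r.
by move=> phi; rewrite AA scale0r.
Qed.

Lemma commutator_plane_phase mu i psi : commutator (P mu) (phase_op i) psi =
  ('i * (V mu i)%:C) *: psi.
Proof.
have [_ _ _ PP] := plane.
rewrite commutatorD !commutatorZ !PP !scalerA -scalerDl mxE; congr (_ *: _).
rewrite !big_ord_recl big_ord0 !mxE (_ : lift ord0 ord0 = 1); last exact: val_inj.
by rewrite addr0 rmorphD !rmorphM /=; ring.
Qed.

(** One factor ['i] comes from the plane and one from the exponent; their product -1 makes the
    eigenvalue real. *)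
Lemma commutator_plane_expi mu i psi :
  commutator (P mu) (E i) psi = - (V mu i)%:C *: E i psi.
Proof.
rewrite (expi_commutator (is_expi_phase_op i) (commutator_plane_phase mu i)).
by rewrite mulrA -expr2 sqrCi mulN1r.
Qed.

(** The commutator is the scalar -i k_j theta k_i^T, zero by admissibility; expanding the second
    phase is what puts [j] before [i]. *)
Lemma commute_phase_phase i j : commute_op (phase_op i) (phase_op j).
Proof.
move=> psi; have [_ /(_ j i)] := adm; rewrite -mulmxA.
move=> /(congr1 (fun M : 'M[R]_(1, 1) => M 0 0)); rewrite [LHS]mxE [RHS]mxE => kk.
have {}kk : \sum_mu k j 0 mu * V mu i = 0.
  rewrite -[RHS]kk; apply: eq_bigr => mu _; congr (_ * _); rewrite !mxE.
  by apply: eq_bigr => nu _; rewrite !mxE.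
rewrite commutatorD !commutatorZ !(commutator_sym (phase_op i)).
rewrite !commutator_plane_phase -!scaleNr !scalerA -scalerDl.
rewrite !big_ord_recl big_ord0 addr0 (_ : lift ord0 ord0 = 1) in kk; last exact: val_inj.
move/(congr1 (fun x => - 'i * x%:C)): kk; rewrite rmorphD !rmorphM rmorph0 mulr0 => kk.
by rewrite -[RHS](scale0r psi) -[in RHS]kk; congr (_ *: _); ring.
Qed.

Lemma commute_op_expi A i : (forall mu, commute_op (P mu) A) -> commute_op A (E i).
Proof.
move=> PA; apply/commute_op_phase_expi/commute_op_phase => mu.
exact: commute_op_sym.
Qed.

Lemma commute_P_Ud mu i : commute_op (P mu) (odag (U i)).
Proof. by apply: commute_op_dagr => //; have [] := plane_cylinder mu i. Qed.

Lemma commute_U_U i j : commute_op (U i) (U j).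
Proof.
have [->|ij] := eqVneq i j; first by apply/commute_opP.
by have [] := cylinder_cylinder ij.
Qed.

Lemma commute_U_Ud i j : commute_op (U i) (odag (U j)).
Proof.
have [_ UUd UdU _ _] := cylinder j.
apply: (commute_op_unitary_dag _ UUd UdU); last exact: commute_U_U.
by rewrite sqrf_eq0 gt_eqF.
Qed.

Lemma commute_U_E i j : commute_op (U i) (E j).
Proof. by apply: commute_op_expi => mu; have [] := plane_cylinder mu i. Qed.

Lemma commute_Ud_E i j : commute_op (odag (U i)) (E j).
Proof. by apply: commute_op_expi => mu; apply: commute_P_Ud. Qed.

Lemma commute_Y_E i j : commute_op (Y i) (E j).
Proof. by apply: commute_op_expi => mu; have [] := plane_cylinder mu i. Qed.

Lemma commute_phase_E i j : commute_op (phase_op i) (E j).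
Proof. exact/commute_op_phase_expi/commute_phase_phase. Qed.

Lemma commute_E_E i j : commute_op (E i) (E j).
Proof. exact/commute_op_phase_expi/commute_op_sym/commute_phase_E. Qed.

(** Daggering precedes exponentiation: the Hermitian [phase_op i] commutes with [E j], hence with
    its adjoint, which then commutes with [E i]. *)
Lemma commute_E_Ed i j : commute_op (E i) (odag (E j)).
Proof.
apply/commute_op_sym/commute_op_phase_expi/commute_op_sym.
by apply: commute_op_dagr (@hermitian_phase i) (commute_phase_E i j).
Qed.

Lemma commute_circle i j : commute_op (circle_op i) (circle_op j).
Proof.
apply: commute_op_mul; apply/commute_op_sym/commute_op_mul.
- exact: commute_U_U.
- exact: commute_U_E.
- exact/commute_op_sym/commute_U_E.
- exact: commute_E_E.
Qed.

(** For [i = j] this is normality of the wave. *)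
Lemma commute_circle_dag i j : commute_op (circle_op i) (odag (circle_op j)).
Proof.
apply: commute_op_mul_dag; apply/commute_op_sym/commute_op_mul.
- exact/commute_op_sym/commute_U_Ud.
- exact: commute_Ud_E.
- exact/commute_op_sym/(commute_op_dag (commute_Ud_E i j)).
- exact/commute_op_sym/commute_E_Ed.
Qed.

Lemma commutator_coord p q psi : commutator (coord_op p) (coord_op q) psi =
  ('i * (linear_bracket theta p q)%:C) *: psi.
Proof.
have [_ _ _ PP] := plane.
have E0 : ('i * 0%:C) *: psi = 0 by rewrite mulr0 scale0r.
rewrite /coord_op /linear_bracket; move: p q.
apply: ord22_ind => [mu|i]; apply: ord22_ind => [nu|j];
  rewrite ?block_mxEul ?block_mxEur ?block_mxEdl ?block_mxEdr ?mxE
    ?(unsplitK (inl _)) ?(unsplitK (inr _)) ?E0 //.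
- by have [_ ->] := plane_cylinder mu j.
- by rewrite commutator_sym; have [_ ->] := plane_cylinder nu i; rewrite oppr0.
- have [->|ij] := eqVneq i j; first by rewrite /commutator subrr.
  by have [_ _ ->] := cylinder_cylinder ij.
Qed.

Lemma hermitian_coord p : hermitian_op (coord_op p).
Proof. by rewrite /coord_op; case: fintype.split. Qed.

(** By the Leibniz rule: plane coordinates see only [E i] and cylinder coordinates only [U i], which
    yields the two blocks of [phase_bracket]. *)
Lemma commutator_coord_circle p i psi : commutator (coord_op p) (circle_op i) psi =
  - (alpha p i)%:C *: circle_op i psi.
Proof.
rewrite commutator_mul /coord_op /phase_bracket; move: p.
apply: ord22_ind => [mu|j]; rewrite ?col_mxEu ?col_mxEd
    ?(unsplitK (inl _)) ?(unsplitK (inr _)).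
- by have [-> _] := plane_cylinder mu i; rewrite add0r commutator_plane_expi linearZ.
- rewrite (commute_Y_E j i) linear0 addr0 !mxE eq_sym.
  have [<-|ij] := eqVneq i j.
    have [_ _ _ UY _] := cylinder i.
    by rewrite commutator_sym UY mulr1n scaleNr.
  have [_ UY _] := cylinder_cylinder ij.
  by rewrite commutator_sym UY mulr0n rmorph0 !oppr0 scale0r.
Qed.

Lemma commute_op_brane A (b : 'I_10) : (forall i, commute_op A (circle_op i)) ->
  (forall i, commute_op A (odag (circle_op i))) -> (3 < b)%N ->
  commute_op A (X b).
Proof.
move=> AZ AZd; case: (indexP b) => [p|i|i|{}b b7] b3.
- by move: b3; rewrite ltnNge -ltnS (ltn_ord p).
- by rewrite brane_cos; apply: commute_op_Re.
- by rewrite brane_sin; apply: commute_op_Im.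
- by rewrite brane_null //; apply/commute_opP => psi /=; rewrite linear0.
Qed.

Lemma commute_brane (a b : 'I_10) : (3 < a)%N -> (3 < b)%N -> commute_op (X a) (X b).
Proof.
move=> a3 b3; apply: commute_op_brane (b3) => i;
  apply/commute_op_sym/commute_op_brane => // j.
- exact: commute_circle.
- exact: commute_circle_dag.
- exact/commute_op_sym/commute_circle_dag.
- exact/commute_op_dag/commute_circle.
Qed.

Lemma commutator_coord_cos p i psi : commutator (X (lin p)) (X (cosx i)) psi =
  'i *: ((- alpha p i)%:C *: X (sinx i) psi).
Proof.
rewrite brane_lin brane_cos brane_sin.
exact: (commutator_Re (hermitian_coord p) (commutator_coord_circle p i)).
Qed.

Lemma commutator_coord_sin p i psi : commutator (X (lin p)) (X (sinx i)) psi =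
  'i *: ((alpha p i)%:C *: X (cosx i) psi).
Proof.
rewrite brane_lin brane_cos brane_sin.
exact: (commutator_Im (hermitian_coord p) (commutator_coord_circle p i)).
Qed.

(** Two successive rotations between the cosine and the sine return the same matrix; the signs and
    both factors ['i] multiply to +1. *)
Lemma double_commutator_circle (p : 'I_(2 + 2)) i (a : 'I_10) psi :
  a = cosx i \/ a = sinx i ->
  commutator (X (lin p)) (commutator (X (lin p)) (X a)) psi =
  (alpha p i ^+ 2)%:C *: X a psi.
Proof.
case=> ->.
- have -> : commutator (X (lin p)) (X (cosx i)) =
      oscale ('i * (- alpha p i)%:C) (X (sinx i)).
    by apply/funext => phi; rewrite commutator_coord_cos scalerA.
  rewrite commutatorZ commutator_coord_sin !scalerA; congr (_ *: _).
  rewrite rmorphN rmorphXn /=.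
  transitivity (- ('i ^+ 2) * (alpha p i)%:C ^+ 2); first by ring.
  by rewrite sqrCi opprK mul1r.
- have -> : commutator (X (lin p)) (X (sinx i)) =
      oscale ('i * (alpha p i)%:C) (X (cosx i)).
    by apply/funext => phi; rewrite commutator_coord_sin scalerA.
  rewrite commutatorZ commutator_coord_cos !scalerA; congr (_ *: _).
  rewrite rmorphN rmorphXn /=.
  transitivity (- ('i ^+ 2) * (alpha p i)%:C ^+ 2); first by ring.
  by rewrite sqrCi opprK mul1r.
Qed.

Lemma commutator0 A psi : commutator A (fun=> 0) psi = 0.
Proof. by rewrite /commutator linear0 subrr. Qed.

Lemma commutator_op0 A psi : commutator A (ozero D) psi = 0.
Proof. by rewrite /commutator /= linear0 subrr. Qed.

Lemma commutator_scalar A c psi : commutator A (fun psi => c *: psi) psi = 0.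
Proof. by rewrite /commutator linearZ subrr. Qed.

Lemma boxE (Z : 'I_10 -> operator D) a psi : box Z a psi = \sum_(b < 10)
  (Defs.eta R 10 b b)%:C *: commutator (Z b) (commutator (Z b) (Z a)) psi.
Proof.
apply: eq_bigr => b _; rewrite (bigD1 b) //= big1 ?addr0 // => c cb.
by rewrite mxE eq_sym (negbTE cb) scale0r.
Qed.

(** The dispersion relation: the plane rows add up to k_i.k_i, and the cylinder rows leave only
    xi_i^2. *)
Lemma light_cone i :
  \sum_(p < 2 + 2) Defs.eta R 10 (lin p) (lin p) * alpha p i ^+ 2 = 0.
Proof.
rewrite big_split_ord /=.
under eq_bigr do rewrite col_mxEu.
under [X in _ + X]eq_bigr do rewrite col_mxEd.
have [thT _ _ _] := plane.
have kV mu : V mu i = - (k i *m theta) 0 mu.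
  rewrite !mxE -sumrN; apply: eq_bigr => nu _.
  by rewrite !mxE (antisymmetric_entry thT) mulNr mulrC.
have [/(_ i) + _] := adm; rewrite (kdotE thT) => ki.
rewrite !big_ord_recl !big_ord0 !addr0 (_ : lift ord0 ord0 = 1); last exact: val_inj.
rewrite (_ : ord0 = 0); last exact: val_inj.
rewrite ![Defs.eta _ _ _ _]mxE !eqxx /= ![Xi _ _ _]mxE ![(\row_j _) _ _]mxE.
rewrite !kV !sqrrN; by move: i ki {kV}; apply: ord2_ind => /= ki; lra.
Qed.

Lemma hermitian_brane a : hermitian_op (X a).
Proof.
case: (indexP a) => [p|i|i|{}a a7].
- by rewrite brane_lin; apply: hermitian_coord.
- by rewrite brane_cos; apply: hermitian_Re.
- by rewrite brane_sin; apply: hermitian_Im.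
- by rewrite brane_null.
Qed.

(** The circle directions commute with [X a]; the four others act by squared eigenvalues, whose sum
    weighted by [eta] is [light_cone]. *)
Lemma box_circle i a psi : a = cosx i \/ a = sinx i -> box X a psi = 0.
Proof.
move=> ai; rewrite boxE (@big_split_ord _ _ _ (2 + 2) 6) /=.
rewrite [X in _ + X]big1 => [|c _].
  rewrite addr0; under eq_bigr => p _.
    rewrite (double_commutator_circle p psi ai) scalerA -rmorphM; over.
  by rewrite -scaler_suml -rmorph_sum light_cone scale0r.
have a3 : (3 < a)%N by case: ai => ->; rewrite ?cosx_val ?sinx_val.
have -> : commutator (X (@rshift 4 6 c)) (X a) = fun=> 0.
  by apply/funext => phi; apply: commute_brane.
by rewrite commutator0 scaler0.
Qed.

(** Each inner commutator with [X b] is a scalar or a multiple of the partner of [X b] on the same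
    circle, and both commute with [X b]. *)
Lemma box_coord p psi : box X (lin p) psi = 0.
Proof.
rewrite boxE big1 // => b _; case: (indexP b) => [q|i|i|{}b b7].
- rewrite (_ : commutator _ (X (lin p)) =
      fun psi => ('i * (linear_bracket theta q p)%:C) *: psi).
    by rewrite commutator_scalar scaler0.
  by apply/funext => phi; rewrite !brane_lin commutator_coord.
- rewrite (_ : commutator _ (X (lin p)) =
      oscale ('i * (alpha p i)%:C) (X (sinx i))).
    by rewrite commutatorZ commute_brane ?scaler0 ?cosx_val ?sinx_val.
  apply/funext => phi.
  rewrite commutator_sym commutator_coord_cos scalerA -scaleNr; congr (_ *: _).
  by rewrite rmorphN /=; ring.
- rewrite (_ : commutator _ (X (lin p)) =
      oscale ('i * (- alpha p i)%:C) (X (cosx i))).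
    by rewrite commutatorZ commute_brane ?scaler0 ?cosx_val ?sinx_val.
  apply/funext => phi.
  rewrite commutator_sym commutator_coord_sin scalerA -scaleNr; congr (_ *: _).
  by rewrite rmorphN /=; ring.
- rewrite (_ : commutator _ (X (lin p)) = fun=> 0) ?commutator0 ?scaler0 //.
  by apply/funext => phi; rewrite brane_null // commutator_sym commutator_op0 oppr0.
Qed.

Lemma brane_ikkt_solution : ikkt_solution X.
Proof.
split=> [|a psi]; first exact: hermitian_brane.
case: (indexP a) => [p|i|i|{}a a7].
- exact: box_coord.
- by apply: (@box_circle i); left.
- by apply: (@box_circle i); right.
- rewrite boxE big1 // => b _; rewrite [X a]brane_null //.
  have -> : commutator (X b) (ozero D) = fun=> 0.
    by apply/funext => phi; rewrite commutator_op0.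
  by rewrite commutator0 scaler0.
Qed.

(** Every bracket here is affine with at most one linear term, so one index and two coefficients,
    shared by operators and functions, describe it. *)
Let bracket_relation (a b s : 'I_10) (c t : R) :=
  (forall psi, commutator (X a) (X b) psi =
     'i *: (c%:C *: X s psi + t%:C *: psi)) /\
  (forall z, poisson_bracket (poisson_tensor theta xi) (brane_embedding r k) z a b =
     c * brane_embedding r k z 0 s + t).

Let bracket_relation_sym a b s c t :
  bracket_relation a b s c t -> bracket_relation b a s (- c) (- t).
Proof.
have [thT _ _ _] := plane.
move=> [op cl]; split=> [psi|z].
  by rewrite commutator_sym op -scalerN opprD !rmorphN !scaleNr.
by rewrite (poisson_bracket_anti r xi k thT) cl opprD mulNr.
Qed.

Let bracket_relation_lin p b :
  exists w : 'I_10 * R * R, bracket_relation (lin p) b w.1.1 w.1.2 w.2.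
Proof.
have [thT _ _ _] := plane.
case: (indexP b) => [q|i|i|{}b b7].
(* The bracket is constant: the index is a placeholder with coefficient 0. *)
- exists (lin p, 0, linear_bracket theta p q); split=> [psi|z] /=.
    by rewrite !brane_lin commutator_coord rmorph0 scale0r add0r scalerA.
  by rewrite bracket_coord_coord // mul0r add0r.
- exists (sinx i, - alpha p i, 0); split=> [psi|z] /=.
    by rewrite commutator_coord_cos rmorph0 scale0r addr0.
  by rewrite bracket_coord_cos // addr0.
- exists (cosx i, alpha p i, 0); split=> [psi|z] /=.
    by rewrite commutator_coord_sin rmorph0 scale0r addr0.
  by rewrite bracket_coord_sin // addr0.
- exists (b, 0, 0); split=> [psi|z] /=.
    by rewrite [X b]brane_null // commutator_op0 !rmorph0 !scale0r addr0 scaler0.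
  rewrite poisson_bracketE // [coord_diff _ _ z b]coord_diff_null // trmx0 mulmx0 mxE.
  by rewrite mul0r addr0.
Qed.

Let bracket_relation_exists a b :
  exists w : 'I_10 * R * R, bracket_relation a b w.1.1 w.1.2 w.2.
Proof.
have lin_lt4 (c : 'I_10) : (c < 4)%N -> exists p, c = lin p.
  move=> c4; exists (Ordinal (c4 : (c < 2 + 2)%N)); exact: val_inj.
have [/lin_lt4[p ->]|a3] := ltnP a 4; first exact: bracket_relation_lin.
have [/lin_lt4[p ->]|b3] := ltnP b 4.
  have [w /bracket_relation_sym ww] := bracket_relation_lin p a.
  by exists (w.1.1, - w.1.2, - w.2).
have [thT _ _ _] := plane.
exists (a, 0, 0); split=> [psi|z] /=.
  by rewrite commute_brane // !rmorph0 !scale0r addr0 scaler0.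
by rewrite bracket_circles // mul0r addr0.
Qed.

Lemma brane_quantizes :
  quantizes X (brane_embedding r k) (poisson_tensor theta xi).
Proof.
(* Choosing one relation per pair of indices gives the structure constants, supported on a single
   [c]. *)
have /choice[g gP] : forall ab : 'I_10 * 'I_10, exists w : 'I_10 * R * R,
    bracket_relation ab.1 ab.2 w.1.1 w.1.2 w.2.
  by move=> ab; apply: bracket_relation_exists.
exists (fun a b c => if c == (g (a, b)).1.1 then (g (a, b)).1.2 else 0).
exists (fun a b => (g (a, b)).2) => a b.
have [op cl] := gP (a, b); split=> [psi|z]; rewrite (bigD1 (g (a, b)).1.1) //= eqxx.
  rewrite big1 => [|c /negbTE ->]; first by rewrite addr0 op.
  by rewrite rmorph0 scale0r.
rewrite big1 => [|c /negbTE ->]; first by rewrite addr0 cl.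
by rewrite mul0r.
Qed.

End Brane.

Theorem mainTheorem1 (R : realType) (H : hilbertSpace R) (D : denseDomain H)
    (theta : 'M[R]_2) (P : 'I_2 -> operator D)
    (r xi : 'I_2 -> R) (U Y : 'I_2 -> operator D)
    (plane : quantum_plane P theta)
    (r_gt0 : forall i, 0 < r i) (xi_neq0 : forall i, xi i != 0)
    (cylinder : forall i, fuzzy_cylinder (U i) (Y i) (r i) (xi i))
    (plane_cylinder : forall mu i,
       commute_op (P mu) (U i) /\ commute_op (P mu) (Y i))
    (cylinder_cylinder : forall i j, i != j ->
       [/\ commute_op (U i) (U j), commute_op (U i) (Y j) &
           commute_op (Y i) (Y j)]) :
  (exists k : 'I_2 -> 'rV[R]_2, admissible theta xi k) /\
  forall (k : 'I_2 -> 'rV[R]_2) (E : 'I_2 -> operator D),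
    admissible theta xi k ->
    (forall i, is_expi (plane_phase P (k i)) (E i)) ->
    ikkt_solution (brane P Y U E) /\
    [/\ embeds_R4_T2 (brane_embedding r k),
        poisson_tensor theta xi \in unitmx,
        quantizes (brane P Y U E) (brane_embedding r k)
          (poisson_tensor theta xi) &
        forall z : coords R, minkowski_signature
          (ulsubmx (effective_metric (poisson_tensor theta xi)
                      (brane_embedding r k) z) : 'M[R]_(2 + 2))].
Proof.
have [theta_anti theta_unit _ _] := plane.
split=> [|k E adm expE]; first exact: admissible_exists.
split; first exact: (brane_ikkt_solution plane r_gt0 cylinder plane_cylinder
    cylinder_cylinder adm expE).
split.
- exact: brane_embeds.
- exact: poisson_tensor_unit.
- exact: (brane_quantizes plane r_gt0 cylinder plane_cylinder
    cylinder_cylinder adm expE).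
- by move=> z; apply: noncompact_minkowski.
Qed.
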